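(* The map $$\mathbb{C}^3\ni(s,t,u) \mapsto (1,\,s,\,t,\,u,\,st,\,su,\,tu,\,s^2,\,s^3-t^2,\,t^3-u^2,\,u^3)\in \mathbb{C}^{11}$$ is $4$-regular, and the map $$\mathbb{C}^3\ni(s,t,u) \mapsto (1,\,s,\,t,\,u,\,st,\,su,\,tu,\,s^2,\,t^2,\,u^2,\,u^3,\,t^4-s^3,\,u^4-t^3,\,s^4)\in \mathbb{C}^{14}$$ is $5$-regular.
   Context: For a positive integer $k$, a map $f:\mathbb{C}^n\rightarrow\mathbb{C}^N$ is called $k$-regular if for any $k$ pairwise distinct points $p_1,\dots,p_k\in\mathbb{C}^n$ the vectors $f(p_1),\dots,f(p_k)\in\mathbb{C}^N$ are linearly independent over $\mathbb{C}$. *)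

(* Defs.v *)
From mathcomp Require Import all_boot all_order all_algebra.
From mathcomp Require Import reals complex.

Set Implicit Arguments.
Unset Strict Implicit.
Unset Printing Implicit Defensive.

Import GRing.Theory.
Local Open Scope ring_scope.
Local Open Scope complex_scope.

(* For R : realType, R[i] is the field of complex numbers and 'rV[R[i]]_n
   is C^n. *)
Definition k_regular (R : realType) (k n N : nat)
    (f : 'rV[R[i]]_n -> 'rV[R[i]]_N) : Prop :=
  forall p : k.-tuple 'rV[R[i]]_n, uniq p -> free [seq f x | x <- p].

Definition map11 (R : realType) (p : 'rV[R[i]]_3) : 'rV[R[i]]_11 :=
  let s := p 0 0 in let t := p 0 1 in let u := p 0 2 in
  \row_(j < 11)
    [:: 1; s; t; u; s * t; s * u; t * u; s ^+ 2;
        s ^+ 3 - t ^+ 2; t ^+ 3 - u ^+ 2; u ^+ 3]`_j.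

Definition map14 (R : realType) (p : 'rV[R[i]]_3) : 'rV[R[i]]_14 :=
  let s := p 0 0 in let t := p 0 1 in let u := p 0 2 in
  \row_(j < 14)
    [:: 1; s; t; u; s * t; s * u; t * u; s ^+ 2; t ^+ 2; u ^+ 2; u ^+ 3;
        t ^+ 4 - s ^+ 3; u ^+ 4 - t ^+ 3; s ^+ 4]`_j.

(* Main.v *)
(** Suppose that the evaluations at n <= k distinct points satisfy a linear
    relation with nonzero coefficients [c] on the span of the coordinate
    functions, and let L = sum_i c_i ev_(p_i). Then (x, y) |-> L(xy) is a
    nondegenerate symmetric form on the functions on the n points. The quadratic
    coordinates make 1, s, t, u (almost) isotropic, and an isotropic subspace
    has dimension at most n/2; hence the points lie on a line, on which any
    nonconstant one among s, t, u is an affine parameter. On a line, L cannot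
    kill the first n powers of a parameter (Vandermonde), and the remaining
    coordinates force it to do so. *)
Require Import Defs.
From mathcomp Require Import all_boot all_order all_algebra.
From mathcomp Require Import reals complex.
From mathcomp Require Import ring.

Set Implicit Arguments.
Unset Strict Implicit.
Unset Printing Implicit Defensive.

Import GRing.Theory.
Local Open Scope ring_scope.

(** * Functionals supported on finitely many points *)

Section Moments.
Variables (F : fieldType) (n : nat) (c : 'I_n -> F).
Implicit Types g h x y s t u : 'I_n -> F.

(** This is the functional L; a function on the n points is given by its values, indexed by
    ['I_n]. *)
Definition moment g : F := \sum_i c i * g i.

Lemma eq_moment g h : g =1 h -> moment g = moment h.
Proof. by move=> e; apply: eq_bigr => i _; rewrite e. Qed.

Lemma moment_sub_eq0 g h :
  moment (fun i => g i - h i) = 0 -> moment g = moment h.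
Proof.
move=> e; apply/eqP; rewrite -subr_eq0 -e /moment -sumrB.
by apply/eqP/eq_bigr => i _; rewrite mulrBr.
Qed.

Lemma constant_or_not g :
  (exists e, forall i, g i = e) \/ (exists i j, g i != g j).
Proof.
case: (pickP [pred ij : 'I_n * 'I_n | g ij.1 != g ij.2]) => [[i j] /= gij|gc].
  by right; exists i, j.
left; case: (pickP 'I_n) => [j _|none]; last by exists 0 => i; have := none i.
by exists (g j) => i; have /= /negbFE/eqP := gc (i, j).
Qed.

Hypothesis moment1 : moment (fun=> 1) = 0.

Lemma moment_constant g e (phi : F -> F) :
  (forall i, g i = e) -> moment (fun i => phi (g i)) = 0.
Proof.
move=> gE; rewrite -(mulr0 (phi e)) -moment1 mulr_sumr.
by apply: eq_bigr => i _; rewrite gE; ring.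
Qed.

Section Affine.
Variables (x y : 'I_n -> F) (a b : F).
Hypothesis yE : forall i, y i = a + b * x i.
Hypotheses (moment_x : moment x = 0) (moment_x2 : moment (fun i => x i ^+ 2) = 0).

Lemma moment_affine_sqr : moment (fun i => y i ^+ 2) = 0.
Proof.
have -> : moment (fun i => y i ^+ 2) = a ^+ 2 * moment (fun=> 1) +
    2 * a * b * moment x + b ^+ 2 * moment (fun i => x i ^+ 2).
  rewrite /moment !mulr_sumr -!big_split /=.
  by apply: eq_bigr => i _; rewrite yE; ring.
by rewrite moment1 moment_x moment_x2 !mulr0 !addr0.
Qed.

(** Only the leading term of (a + b x)^3 survives L. When L(x^3) is nonzero, the factor b^3 lets
    L(y^3) = 0 force b = 0. *)
Lemma moment_affine_cube :
  moment (fun i => y i ^+ 3) = b ^+ 3 * moment (fun i => x i ^+ 3).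
Proof.
have -> : moment (fun i => y i ^+ 3) = a ^+ 3 * moment (fun=> 1) +
    3 * a ^+ 2 * b * moment x + 3 * a * b ^+ 2 * moment (fun i => x i ^+ 2) +
    b ^+ 3 * moment (fun i => x i ^+ 3).
  rewrite /moment !mulr_sumr -!big_split /=.
  by apply: eq_bigr => i _; rewrite yE; ring.
by rewrite moment1 moment_x moment_x2 !mulr0 !add0r.
Qed.

Lemma affine_constant : b = 0 -> forall i, y i = a.
Proof. by move=> b0 i; rewrite yE b0 mul0r addr0. Qed.

End Affine.

(** * Consequences of nondegeneracy *)

Hypothesis c_neq0 : forall i, c i != 0.

(** Sylvester's rank inequality for the product of B D and B^T, where D = diag(c) is invertible. It
    bounds the dimension of isotropic subspaces. *)
Lemma mxrank_gram m (B : 'M[F]_(m, n)) :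
  (2 * \rank B <= n + \rank (B *m diag_mx (\row_i c i) *m B^T))%N.
Proof.
have Dfree : row_free (diag_mx (\row_i c i)).
  rewrite row_free_unit unitmxE det_diag unitfE.
  by apply/prodf_neq0 => i _; rewrite mxE.
have := mxrank_mul_min (B *m diag_mx (\row_i c i)) B^T.
by rewrite mxrankMfree // mxrank_tr addnn -mul2n leq_subLR.
Qed.

(* The Gram matrix of 1, x, y is diag(0, 0, L(y^2)), so these functions span
   at most a plane. *)
Lemma isotropic_affine x y :
  (n + (moment (fun i => y i ^+ 2) != 0)%R <= 5)%N ->
  moment x = 0 -> moment y = 0 -> moment (fun i => x i ^+ 2) = 0 ->
  moment (fun i => x i * y i) = 0 ->
  (exists i j, x i != x j) ->
  exists a b, forall i, y i = a + b * x i.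
Proof.
move=> le5 Lx Ly Lx2 Lxy [i0 [j0 xij]].
pose B := \matrix_(k < 3, i < n) [:: 1; x i; y i]`_k.
set m := moment _ in le5.
have gramE : B *m diag_mx (\row_i c i) *m B^T = m *: delta_mx 2 2.
  have sE k l : (B *m diag_mx (\row_i c i) *m B^T) k l
      = moment (fun i => [:: 1; x i; y i]`_k * [:: 1; x i; y i]`_l).
    rewrite mul_mx_diag mxE; apply: eq_bigr => i _.
    by rewrite !mxE; ring.
  apply/matrixP => k l; rewrite sE !mxE.
  have eL g h : moment h = 0 -> g =1 h -> moment g = 0.
    by move=> h0 /eq_moment ->.
  case: k l => [[|[|[|//]]] ?] [[|[|[|//]]] ?]; rewrite ?mulr0 /=.
  - by apply: (eL _ _ moment1) => i; rewrite mulr1.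
  - by apply: (eL _ _ Lx) => i; rewrite mul1r.
  - by apply: (eL _ _ Ly) => i; rewrite mul1r.
  - by apply: (eL _ _ Lx) => i; rewrite mulr1.
  - by apply: (eL _ _ Lx2).
  - by apply: (eL _ _ Lxy).
  - by apply: (eL _ _ Ly) => i; rewrite mulr1.
  - by apply: (eL _ _ Lxy) => i; rewrite mulrC.
  - by rewrite mulr1.
have rG : (\rank (m *: delta_mx 2 2 : 'M[F]_3)%R <= (m != 0)%R)%N.
  have [->|m0] := eqVneq m 0; first by rewrite scale0r mxrank0.
  by rewrite (leq_trans (mxrank_scale _ _)) // mxrank_delta.
(* Rank 3 would give 6 <= n + rank(Gram) <= 5. *)
have rB : ~~ row_free B.
  rewrite /row_free; apply/negP => /eqP rB.
  have := mxrank_gram B; rewrite gramE rB => le6.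
  by have := leq_trans le6 (leq_trans (leq_add (leqnn n) rG) le5).
move: rB; rewrite -kermx_eq0 => /rowV0Pn [v /sub_kermxP vB v0].
have rel i : v 0 0 + v 0 1 * x i + v 0 2 * y i = 0.
  have /matrixP/(_ 0 i) := vB; rewrite !mxE !big_ord_recl big_ord0 !mxE /= => <-.
  rewrite mulr1 addr0 addrA; congr (_ + v _ _ * _ + v _ _ * _); exact: val_inj.
(* Otherwise v_0 + v_1 x vanishes at two points where x differs, so v = 0. *)
have v2 : v 0 2 != 0.
  apply: contraNneq v0 => v2.
  have rel' i : v 0 0 + v 0 1 * x i = 0 by rewrite -(rel i) v2 mul0r addr0.
  have v1 : v 0 1 = 0.
    apply: contraNeq xij => v1; apply/eqP/(mulfI v1)/(addrI (v 0 0)).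
    by rewrite !rel'.
  have v00 : v 0 0 = 0 by rewrite -(rel' i0) v1 mul0r addr0.
  apply/eqP/rowP => k; rewrite mxE.
  case: k => [[|[|[|//]]] ?]; [rewrite -[RHS]v00|rewrite -[RHS]v1|rewrite -[RHS]v2];
    congr (v _ _); exact: val_inj.
exists (- v 0 0 / v 0 2), (- v 0 1 / v 0 2) => i.
apply: (mulfI v2); apply/eqP; rewrite -subr_eq0 -[X in _ == X](rel i).
by apply/eqP; field.
Qed.

(** Distinct values of x make the Vandermonde matrix invertible, yet its kernel would contain the
    nonzero vector c. *)
Lemma moments_separating x :
  (0 < n)%N -> injective x ->
  ~ (forall j, (j < n)%N -> moment (fun i => x i ^+ j) = 0).
Proof.
move=> n_gt0 xinj mx0.
pose V := Vandermonde n (\row_i x i).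
have Vunit : V \in unitmx.
  rewrite unitmxE det_Vandermonde unitfE.
  apply/prodf_neq0 => i _; apply/prodf_neq0 => j ij.
  by rewrite !mxE subr_eq0; apply: contraTneq ij => /xinj ->; rewrite ltnn.
have Vc : V *m (\col_i c i) = 0.
  apply/colP => j; rewrite mxE [RHS]mxE -[RHS](mx0 j (ltn_ord j)).
  by apply: eq_bigr => i _; rewrite !mxE mulrC.
have := congr1 (mulmx (invmx V)) Vc.
rewrite mulKmx // mulmx0 => /colP/(_ (Ordinal n_gt0)).
by rewrite !mxE => /eqP; apply/negP.
Qed.

(** * Three coordinates separating the points *)

Section Triple.
Variables s t u : 'I_n -> F.
Hypothesis n_gt0 : (0 < n)%N.
Hypothesis separate :
  forall i j, s i = s j -> t i = t j -> u i = u j -> i = j.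
Hypotheses (Ls : moment s = 0) (Lt : moment t = 0) (Lu : moment u = 0).
Hypotheses (Lst : moment (fun i => s i * t i) = 0)
  (Lsu : moment (fun i => s i * u i) = 0)
  (Ltu : moment (fun i => t i * u i) = 0)
  (Ls2 : moment (fun i => s i ^+ 2) = 0).

Lemma separate_s : (exists a b, forall i, t i = a + b * s i) ->
  (exists a b, forall i, u i = a + b * s i) -> injective s.
Proof.
by move=> [a [b tE]] [a' [b' uE]] i j e; apply: separate; rewrite ?tE ?uE e.
Qed.

Lemma separate_t : (exists e, forall i, s i = e) ->
  (exists a b, forall i, u i = a + b * t i) -> injective t.
Proof.
by move=> [e sE] [a' [b' uE]] i j e'; apply: separate; rewrite ?sE ?uE ?e'.
Qed.

Lemma separate_u : (exists e, forall i, s i = e) ->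
  (exists e, forall i, t i = e) -> injective u.
Proof. by move=> [e sE] [e' tE] i j e''; apply: separate; rewrite ?sE ?tE. Qed.

Lemma moments_low x : injective x -> moment x = 0 ->
  moment (fun i => x i ^+ 2) = 0 -> moment (fun i => x i ^+ 3) = 0 ->
  ((n <= 4)%N \/ (n <= 5)%N /\ moment (fun i => x i ^+ 4) = 0) -> False.
Proof.
move=> xinj x1 x2 x3 n_le; apply: (moments_separating n_gt0 xinj) => j jn.
(* The fourth moment enters only when n = 5. *)
case: j jn => [|[|[|[|[|j]]]]] jn //.
- by case: n_le => [le4|[_ //]]; have := leq_trans jn le4.
- by case: n_le => [le4|[le5 _]]; [have := leq_trans jn le4 | have := leq_trans jn le5].
Qed.

(** If s is nonconstant, t is affine in s, so L(s^3) = L(t^2) = 0, against Vandermonde. If s is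
    constant, L(t^2) = L(s^3) = 0 and t takes over the role of s. If t is constant too, L(u^2) =
    L(t^3) = 0 and u separates the points. *)
Lemma no_relation_map11 : (n <= 4)%N ->
  moment (fun i => s i ^+ 3 - t i ^+ 2) = 0 ->
  moment (fun i => t i ^+ 3 - u i ^+ 2) = 0 ->
  moment (fun i => u i ^+ 3) = 0 -> False.
Proof.
move=> n4 /moment_sub_eq0 Ls3 /moment_sub_eq0 Lt3 Lu3.
(* With n <= 4 the Gram matrix may have rank 1, so L(y^2) can be arbitrary. *)
have le5 (b : bool) : (n + b <= 5)%N by exact: leq_add n4 (leq_b1 b).
have low x : injective x -> moment x = 0 -> moment (fun i => x i ^+ 2) = 0 ->
    moment (fun i => x i ^+ 3) <> 0.
  by move=> xi x1 x2 x3; apply: (moments_low xi x1 x2 x3); left.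
case: (constant_or_not s) => [sc|snc]; last first.
  have [a [b tE]] := isotropic_affine (le5 _) Ls Lt Ls2 Lst snc.
  have uE := isotropic_affine (le5 _) Ls Lu Ls2 Lsu snc.
  apply: (low s) => //; first by apply: separate_s => //; exists a, b.
  by rewrite Ls3; exact: moment_affine_sqr tE Ls Ls2.
have Lt2 : moment (fun i => t i ^+ 2) = 0.
  by rewrite -Ls3; case: sc => e /(moment_constant (fun z => z ^+ 3)).
case: (constant_or_not t) => [tc|tnc]; last first.
  have [a [b uE]] := isotropic_affine (le5 _) Lt Lu Lt2 Ltu tnc.
  apply: (low t) => //; first by apply: separate_t => //; exists a, b.
  by rewrite Lt3; exact: moment_affine_sqr uE Lt Lt2.
apply: (low u) => //; first exact: separate_u.
by rewrite -Lt3; case: tc => e /(moment_constant (fun z => z ^+ 3)).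
Qed.

(** If s is nonconstant, Vandermonde gives L(s^3) != 0. Then L(u^3) = 0 makes u constant, so L(t^3)
    = L(u^4) = 0; this makes t constant, so L(s^3) = L(t^4) = 0, a contradiction. For constant s the
    same chain starts at t, then at u. *)
Lemma no_relation_map14 : (n <= 5)%N ->
  moment (fun i => t i ^+ 2) = 0 -> moment (fun i => u i ^+ 2) = 0 ->
  moment (fun i => u i ^+ 3) = 0 ->
  moment (fun i => t i ^+ 4 - s i ^+ 3) = 0 ->
  moment (fun i => u i ^+ 4 - t i ^+ 3) = 0 ->
  moment (fun i => s i ^+ 4) = 0 -> False.
Proof.
move=> n5 Lt2 Lu2 Lu3 /moment_sub_eq0 Lt4 /moment_sub_eq0 Lu4 Ls4.
have low x : injective x -> moment x = 0 -> moment (fun i => x i ^+ 2) = 0 ->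
    moment (fun i => x i ^+ 4) = 0 -> moment (fun i => x i ^+ 3) <> 0.
  by move=> xi x1 x2 x4 x3; apply: (moments_low xi x1 x2 x3); right.
have aff x y : moment x = 0 -> moment y = 0 -> moment (fun i => x i ^+ 2) = 0 ->
    moment (fun i => x i * y i) = 0 -> moment (fun i => y i ^+ 2) = 0 ->
    (exists i j, x i != x j) -> exists a b, forall i, y i = a + b * x i.
  by move=> x1 y1 x2 xy y2; apply: isotropic_affine; rewrite // y2 eqxx addn0.
(* If y = a + b x with L(x^3) <> 0 = L(y^3), then b = 0. *)
have const4 x y : moment x = 0 -> moment (fun i => x i ^+ 2) = 0 ->
    moment (fun i => y i ^+ 3) = 0 -> moment (fun i => x i ^+ 3) != 0 ->
    (exists a b, forall i, y i = a + b * x i) -> moment (fun i => y i ^+ 4) = 0.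
  move=> x1 x2 y3 x3 [a [b yE]]; apply: (@moment_constant y a (fun z => z ^+ 4)).
  apply: (affine_constant yE); apply/eqP.
  have /eqP := moment_affine_cube yE x1 x2.
  by rewrite y3 eq_sym mulf_eq0 (negbTE x3) orbF expf_eq0.
case: (constant_or_not s) => [sc|snc]; last first.
  have tE := aff _ _ Ls Lt Ls2 Lst Lt2 snc.
  have uE := aff _ _ Ls Lu Ls2 Lsu Lu2 snc.
  have Ls3 : moment (fun i => s i ^+ 3) != 0.
    by apply/eqP; apply: low => //; exact: separate_s.
  have Lt3 : moment (fun i => t i ^+ 3) = 0 by rewrite -Lu4; exact: const4 uE.
  by move/eqP: (Ls3); apply; rewrite -Lt4; exact: const4 tE.
have Ls3 : moment (fun i => s i ^+ 3) = 0.
  by case: sc => e /(moment_constant (fun z => z ^+ 3)).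
case: (constant_or_not t) => [tc|tnc]; last first.
  have uE := aff _ _ Lt Lu Lt2 Ltu Lu2 tnc.
  have Lt3 : moment (fun i => t i ^+ 3) != 0.
    apply/eqP; apply: low => //; first exact: separate_t.
    by rewrite Lt4.
  by move/eqP: (Lt3); apply; rewrite -Lu4; exact: const4 uE.
apply: (low u) => //; first exact: separate_u.
by rewrite Lu4; case: tc => e /(moment_constant (fun z => z ^+ 3)).
Qed.

End Triple.
End Moments.

(** * From regularity to functionals *)

(** Restricting a dependency to its support A makes all coefficients nonzero, at the price of
    allowing any n <= k points. *)
Lemma k_regular_no_relation (R : realType) k m N (f : 'rV[R[i]]_m -> 'rV[R[i]]_N) :
  (forall n (q : 'I_n -> 'rV[R[i]]_m) (c : 'I_n -> R[i]),
     (0 < n <= k)%N -> injective q -> (forall i, c i != 0) ->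
     ~ (forall j, moment c (fun i => f (q i) 0 j) = 0)) ->
  k_regular k f.
Proof.
move=> norel p p_uniq.
change (is_true (free (map_tuple f p))); apply/freeP => c rel.
pose A : {set 'I_k} := [set i | c i != 0].
have [A0 i|[i0 iA]] := set_0Vmem A.
  by apply/eqP/negbFE; rewrite -[LHS](in_set (fun i => c i != 0)) -/A A0 inE.
case: (norel #|A| (fun i => tnth p (enum_val i)) (fun i => c (enum_val i))).
- by rewrite -[X in (_ < _ <= X)%N]card_ord max_card andbT; apply/card_gt0P; exists i0.
- by move=> i j /(tuple_uniqP _ p_uniq)/enum_val_inj.
- by move=> i; have := enum_valP i; rewrite inE.
move=> j; rewrite /moment -(big_enum_val (fun i => c i * f (tnth p i) 0 j)).
have /rowP/(_ j) := rel; rewrite summxE mxE => rel_j.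
rewrite -[RHS]rel_j big_mkcond; apply: eq_bigr => i _.
rewrite inE -tnth_nth tnth_map mxE.
by case: eqVneq => [->|//]; rewrite mul0r.
Qed.

Lemma rV3_inj (F : fieldType) (v w : 'rV[F]_3) :
  v 0 0 = w 0 0 -> v 0 1 = w 0 1 -> v 0 2 = w 0 2 -> v = w.
Proof.
move=> e0 e1 e2; apply/rowP => -[[|[|[|//]]] hk].
- by move: e0; congr (v _ _ = w _ _); exact: val_inj.
- by move: e1; congr (v _ _ = w _ _); exact: val_inj.
- by move: e2; congr (v _ _ = w _ _); exact: val_inj.
Qed.

Theorem theorem1p4 (R : realType) :
  k_regular 4 (@map11 R) /\ k_regular 5 (@map14 R).
Proof.
split; apply: k_regular_no_relation => n q c /andP[n_gt0 n_le] q_inj c_neq0 rel.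
(* [L j] says that the functional kills the j-th coordinate function, counted from 0; the list entry
   is found by conversion. *)
- have L (j : nat) (hj : (j < 11)%N) := etrans (eq_moment c
    (fun i => esym (mxE _ _ 0 (Ordinal hj)))) (rel (Ordinal hj)).
  have sep i j : q i 0 0 = q j 0 0 -> q i 0 1 = q j 0 1 -> q i 0 2 = q j 0 2 ->
      i = j.
    by move=> e0 e1 e2; exact/q_inj/rV3_inj.
  exact: (@no_relation_map11 _ n c (L 0 isT) c_neq0 _ _ _ n_gt0 sep
    (L 1 isT) (L 2 isT) (L 3 isT) (L 4 isT) (L 5 isT) (L 6 isT)
    (L 7 isT) n_le (L 8 isT) (L 9 isT) (L 10 isT)).
- have L (j : nat) (hj : (j < 14)%N) := etrans (eq_moment c
    (fun i => esym (mxE _ _ 0 (Ordinal hj)))) (rel (Ordinal hj)).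
  have sep i j : q i 0 0 = q j 0 0 -> q i 0 1 = q j 0 1 -> q i 0 2 = q j 0 2 ->
      i = j.
    by move=> e0 e1 e2; exact/q_inj/rV3_inj.
  exact: (@no_relation_map14 _ n c (L 0 isT) c_neq0 _ _ _ n_gt0 sep
    (L 1 isT) (L 2 isT) (L 3 isT) (L 4 isT) (L 5 isT) (L 6 isT)
    (L 7 isT) n_le (L 8 isT) (L 9 isT) (L 10 isT) (L 11 isT) (L 12 isT) (L 13 isT)).
Qed.
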